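(* Let $G$ be a finite group and $N$ an abelian normal subgroup of $G$ such that the sequence $1\to N\to G\to H\to 1$, with $H=G/N$, splits. Then the exact sequences $$1\to\mathrm{Aut}^{N,H}(G)\to\mathrm{Aut}_N^H(G)\to C_1^*\to 1$$ and $$1\to\mathrm{Aut}^{N,H}(G)\to\mathrm{Aut}^N(G)\to C_2^*\to 1$$ split. Further, if $N$ is a central subgroup of $G$, then the exact sequence $$1\to\mathrm{Aut}^{N,H}(G)\to\mathrm{Aut}_N(G)\to C^*\to 1$$ also splits.
   Context: A short exact sequence of groups $1\to A\to E\to Q\to 1$ splits if the map $E\to Q$ has a section that is a group homomorphism. Let $\pi:G\to H=G/N$ be the projection and fix a left transversal $t:H\to G$ (so $\pi(t(x))=x$) with $t(1)=1$. $H$ acts on $N$ on the right by $n^x=t(x)^{-1}n\,t(x)$. Define $\mu:H\times H\to N$ by $t(xy)\mu(x,y)=t(x)t(y)$; this is a normalized $2$-cocycle. $H^2(H,N)$ denotes normalized $2$-cocycles ($f(x,1)=f(1,x)=1$, $f(xy,z)f(x,y)^z=f(x,yz)f(y,z)$) modulo $2$-coboundaries $(x,y)\mapsto\chi(x)^y\chi(y)\chi(xy)^{-1}$ with $\chi:H\to N$, $\chi(1)=1$. $\mathrm{Aut}_N(G)$: automorphisms $\gamma$ of $G$ with $\gamma(N)=N$. $\mathrm{Aut}_N^H(G)$: those in $\mathrm{Aut}_N(G)$ inducing the identity on $H$. $\mathrm{Aut}^N(G)$: automorphisms of $G$ fixing $N$ elementwise. $\mathrm{Aut}^{N,H}(G)$: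 automorphisms of $G$ fixing $N$ elementwise and inducing the identity on $H$. $C_1=\{\theta\in\mathrm{Aut}(N):\theta(n^x)=\theta(n)^x\ \forall n\in N,x\in H\}$ and $C_2=\{\phi\in\mathrm{Aut}(H): n^{\phi(x)}=n^x\ \forall n\in N,x\in H\}$. For $\theta\in C_1$, $\lambda_1(\theta)\in H^2(H,N)$ is the class of $(x,y)\mapsto\mu(x,y)\theta(\mu(x,y)^{-1})$; for $\phi\in C_2$, $\lambda_2(\phi)$ is the class of $(x,y)\mapsto\mu(\phi(x),\phi(y))\mu(x,y)^{-1}$; when $N$ is central, for $(\theta,\phi)\in\mathrm{Aut}(N)\times\mathrm{Aut}(H)$, $\lambda(\theta,\phi)$ is the class of $(x,y)\mapsto\mu(\phi(x),\phi(y))\theta(\mu(x,y))^{-1}$. These are independent of $t$. Put $C_1^*=\{\theta\in C_1:\lambda_1(\theta)=1\}$, $C_2^*=\{\phi\in C_2:\lambda_2(\phi)=1\}$ and, for $N$ central, $C^*=\{(\theta,\phi)\in\mathrm{Aut}(N)\times\mathrm{Aut}(H):\lambda(\theta,\phi)=1\}$; these are groups. In the three sequences the first nontrivial map is inclusion. The map onto $C_1^*$ is $\gamma\mapsto\gamma|_N$; the map onto $C_2^*$ sends $\gamma$ to the automorphism of $H$ it induces; the map onto $C^*$ sends $\gamma$ to the pair ($\gamma|_N$, induced automorphism of $H$). All three sequences are known to be exact (the third for $N$ central). *)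

(* Defs.v *)
From HB Require Import structures.
From mathcomp Require Import all_boot all_fingroup all_solvable.

Set Implicit Arguments.
Unset Strict Implicit.
Unset Printing Implicit Defensive.

Import GroupScope.

Section ShortExact.

Variables aT rT : finGroupType.
Implicit Types (A E : {set aT}) (Q : {set rT}) (f : aT -> rT).

(* 1 -> A -> E -> Q -> 1, the map out of A being the inclusion and the map out
   of E being f.  The values of f outside E play no role. *)
Definition short_exact A E Q f : Prop :=
  [/\ [/\ group_set A, group_set E & group_set Q],
      {in E &, {morph f : x y / x * y}},
      A \subset E,
      f @: E = Q
    & [set x in E | f x == 1] = A].

Definition has_section E Q f : Prop :=
  exists2 s : {morphism Q >-> aT},
    {in Q, forall q, s q \in E} & {in Q, forall q, f (s q) = q}.

Definition split_short_exact A E Q f : Prop :=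
  short_exact A E Q f /\ has_section E Q f.

End ShortExact.

(* The ambient group G is the whole type gT, so that the quotient G / N is the
   whole type coset_of N (see quotientT_setT below). *)

Section Automorphisms.

Variables (gT : finGroupType) (N : {group gT}).
Implicit Types g : {perm gT}.

Definition quo_perm g : {perm coset_of N} :=
  actperm ([Aut [set: gT]] / N) g.

(* g(N) = N *)
Definition Aut_stab : {set {perm gT}} := 'N_(Aut [set: gT])(N | 'P).

(* g(n) = n for all n in N *)
Definition Aut_fix : {set {perm gT}} := 'C_(Aut [set: gT])(N | 'P).

Definition Aut_stab_quo : {set {perm gT}} :=
  [set g in Aut_stab | quo_perm g == 1].

Definition Aut_fix_quo : {set {perm gT}} :=
  [set g in Aut_fix | quo_perm g == 1].

End Automorphisms.

(* The pointwise group structure on finite functions is in the library, but not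
   its join with the finite type structure. *)
HB.instance Definition _ (aT : finType) (rT : finGroupType) :=
  Group.on {ffun aT -> rT}.

Section Cohomology.

Variables (gT : finGroupType) (N : {group gT}) (t : coset_of N -> gT).
Local Notation H := (coset_of N).
Implicit Types (f : {ffun H * H -> gT}) (chi : {ffun H -> gT}) (x y z : H).
Implicit Types (theta : {perm gT}) (phi : {perm H}).

(* n ^ t x = (t x)^-1 * n * t x is the right action of x on n. *)

Definition cocycle2 : {set {ffun H * H -> gT}} :=
  [set f : {ffun H * H -> gT} |
     [&& [forall u, f u \in N],
         [forall x, (f (x, 1) == 1) && (f (1, x) == 1)]
       & [forall x, forall y, forall z,
            f (x * y, z) * f (x, y) ^ t z == f (x, y * z) * f (y, z)]]].

Definition cobound chi : {ffun H * H -> gT} :=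
  [ffun u => chi u.1 ^ t u.2 * chi u.2 * (chi (u.1 * u.2))^-1].

Definition coboundary2 : {set {ffun H * H -> gT}} :=
  [set cobound chi | chi : {ffun H -> gT}
                       & [forall x, chi x \in N] && (chi 1 == 1)].

Definition H2 : {set coset_of coboundary2} := cocycle2 / coboundary2.

(* Outside the normaliser of coboundary2 the projection coset is trivial by
   convention; all the cochains considered here normalise coboundary2 as soon as
   N is abelian (see H2_class_eq1). *)
Definition H2_class f : coset_of coboundary2 := coset coboundary2 f.

Definition mu x y : gT := (t (x * y))^-1 * (t x * t y).

(* An automorphism of N is a permutation of gT that is trivial outside N. *)

Definition C1 : {set {perm gT}} :=
  [set theta in Aut N |
     [forall n in N, forall x, theta (n ^ t x) == theta n ^ t x]].

Definition C2 : {set {perm H}} :=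
  [set phi in Aut [set: H] |
     [forall n in N, forall x, n ^ t (phi x) == n ^ t x]].

Definition lambda1 theta : coset_of coboundary2 :=
  H2_class [ffun u => mu u.1 u.2 * theta (mu u.1 u.2)^-1].

Definition lambda2 phi : coset_of coboundary2 :=
  H2_class [ffun u => mu (phi u.1) (phi u.2) * (mu u.1 u.2)^-1].

Definition lambda theta phi : coset_of coboundary2 :=
  H2_class [ffun u => mu (phi u.1) (phi u.2) * (theta (mu u.1 u.2))^-1].

Definition C1star : {set {perm gT}} := [set theta in C1 | lambda1 theta == 1].

Definition C2star : {set {perm H}} := [set phi in C2 | lambda2 phi == 1].

Definition Cstar : {set {perm gT} * {perm H}} :=
  [set p in setX (Aut N) (Aut [set: H]) | lambda p.1 p.2 == 1].

End Cohomology.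

Section Facts.

Variables (gT : finGroupType) (N : {group gT}).

Lemma quotientT_setT : [set: gT] / N = [set: coset_of N].
Proof.
apply/setP=> x; rewrite inE; have [y _ ->] := cosetP x.
by apply: mem_quotient; rewrite inE.
Qed.

Hypothesis nsN : N <| [set: gT].

Lemma quo_permE g x :
  g \in Aut_stab N -> quo_perm N g (coset N x) = coset N (g x).
Proof.
case/setIP=> Ag nNg; have nNx : x \in 'N(N).
  by apply: subsetP (in_setT x); case/andP: nsN.
rewrite /quo_perm actpermE qactE // qact_domE ?subsetT //.
by move: Ag nNg; rewrite !inE => -> ->.
Qed.

Hypothesis abN : abelian N.
Variable t : coset_of N -> gT.
Hypothesis tK : forall x, coset N (t x) = x.
Local Notation H := (coset_of N).
Implicit Types (f : {ffun H * H -> gT}) (x y z : H).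

Let nNx g : g \in 'N(N).
Proof. by apply: subsetP (in_setT g); case/andP: nsN. Qed.

Let cN : {in N &, forall a b, a * b = b * a}.
Proof. by move=> a b Na Nb; apply: (centsP abN). Qed.

Let NJ a g : (a ^ g \in N) = (a \in N).
Proof. exact: memJ_norm. Qed.

Lemma mu_in x y : mu t x y \in N.
Proof.
apply: coset_idr => //; rewrite /mu morphM ?morphV ?morphM ?nNx //= !tK.
by rewrite mulVg.
Qed.

Let actM a x y : a \in N -> a ^ t (x * y) = (a ^ t x) ^ t y.
Proof.
move=> Na; rewrite -conjgM -[t x * t y](mulKVg (t (x * y))) -/(mu t x y) conjgM.
by rewrite [RHS]conjgE -(cN (mu_in _ _)) ?NJ // mulKg.
Qed.

Let mulACA a b c d :
  a \in N -> b \in N -> c \in N -> d \in N -> (a * b) * (c * d) = (a * c) * (b * d).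
Proof.
by move=> Na Nb Nc Nd; rewrite -!mulgA; congr (_ * _); rewrite !mulgA (cN Nb).
Qed.

Let ffunM f f' u : (f * f') u = f u * f' u.
Proof. by rewrite ffunE. Qed.

Lemma group_set_cocycle2 : group_set (cocycle2 t).
Proof.
apply/group_setP; split=> [|f f'].
  rewrite inE; apply/and3P; split; first by apply/forallP=> u; rewrite ffunE.
    by apply/forallP=> x; rewrite !ffunE eqxx.
  do 3!apply/forallP=> ?; rewrite !ffunE.
  by rewrite conj1g.
rewrite !inE => /and3P[/forallP Nf /forallP f1 /forallP cf].
case/and3P=> /forallP Nf' /forallP f1' /forallP cf'.
apply/and3P; split; first by apply/forallP=> u; rewrite ffunM groupM.
  apply/forallP=> x; rewrite !ffunM.
  have /andP[/eqP-> /eqP->] := f1 x; have /andP[/eqP-> /eqP->] := f1' x.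
  by rewrite mulg1 eqxx.
apply/forallP=> x; apply/forallP=> y; apply/forallP=> z; rewrite !ffunM conjMg.
have /eqP E := forallP (forallP (cf x) y) z.
have /eqP E' := forallP (forallP (cf' x) y) z.
by rewrite mulACA ?NJ // E E' mulACA.
Qed.

Lemma group_set_coboundary2 : group_set (coboundary2 t).
Proof.
apply/group_setP; split=> [|f f'].
  apply/imsetP; exists 1; last first.
    by apply/ffunP=> u; rewrite !ffunE conj1g !mulg1 ?invg1 ?mulg1.
  by rewrite inE ffunE eqxx andbT; apply/forallP=> x; rewrite ffunE.
case/imsetP=> c; rewrite inE => /andP[/forallP Nc /eqP c1] ->.
case/imsetP=> d; rewrite inE => /andP[/forallP Nd /eqP d1] ->.
apply/imsetP; exists (c * d).
  rewrite inE ffunE c1 d1 mulg1 eqxx andbT.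
  by apply/forallP=> x; rewrite ffunE groupM.
apply/ffunP=> u; rewrite !ffunE conjMg invMg.
have Np : c u.1 ^ t u.2 \in N by rewrite NJ.
have Nq : d u.1 ^ t u.2 \in N by rewrite NJ.
move: (c u.1 ^ _) (d u.1 ^ _) Np Nq => p q Np Nq.
rewrite mulACA ?groupM ?groupV // (mulACA (a := p)) //.
by rewrite (cN (x := (c _)^-1)) ?groupV.
Qed.

Lemma coboundary2_sub : t 1 = 1 -> coboundary2 t \subset cocycle2 t.
Proof.
move=> t1; apply/subsetP=> _ /imsetP[c + ->].
rewrite !inE => /andP[/forallP Nc /eqP c1].
apply/and3P; split.
- apply/forallP=> u; rewrite ffunE; have: c u.1 ^ t u.2 \in N by rewrite NJ.
  by move: (c u.1 ^ _) => p Np; rewrite !groupM ?groupV.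
- apply/forallP=> x; rewrite !ffunE /= c1 t1 conj1g conjg1 !mulg1 !mul1g.
  by rewrite mulgV eqxx.
apply/forallP=> x; apply/forallP=> y; apply/forallP=> z; rewrite !ffunE /=.
have ->: (c x ^ t y * c y * (c (x * y))^-1) ^ t z =
         c x ^ t (y * z) * c y ^ t z * (c (x * y) ^ t z)^-1.
  by rewrite actM // (conjMg (c x ^ t y * c y)) (conjMg (c x ^ t y)) conjVg.
rewrite (mulgA x y z); apply/eqP.
have := conj (NJ (c x) (t (y * z))) (conj (NJ (c y) (t z)) (NJ (c (x * y)) (t z))).
rewrite !Nc; case; move: (_ ^ _) => a Na []; move: (c y ^ _) => b Nb.
move: (_ ^ _) => p Np; have := groupVr (Nc (x * y * z)); move: (_^-1) => q Nq.
move: (c (y * z)) (c z) (Nc (y * z)) (Nc z) => r w Nr Nw.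
have pVK k s : k \in N -> s \in N -> k * s * k^-1 = s.
  by move=> Nk Ns; rewrite (cN (x := k)) ?mulgK.
have ->: p * w * q * (a * b * p^-1) = p * (w * q * (a * b)) * p^-1.
  by rewrite !mulgA.
have ->: a * r * q * (b * w * r^-1) = a * (r * (q * b * w) * r^-1).
  by rewrite !mulgA.
rewrite !pVK ?groupM // (cN (x := w * q)) ?groupM // (cN (x := q)) //.
by rewrite (cN (x := w)) // !mulgA.
Qed.

Lemma H2_class_eq1 f :
  (forall u, f u \in N) -> (H2_class t f == 1) = (f \in coboundary2 t).
Proof.
move=> Nf; pose B := Group group_set_coboundary2.
have nBf : f \in 'N(B).
  apply/normP/setP=> h; suff EJ k : k \in B -> k ^ f = k.
    apply/imsetP/idP=> [[k Bk ->]|Bh]; first by rewrite EJ.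
    by exists h; rewrite ?EJ.
  case/imsetP=> c; rewrite inE => /andP[/forallP Nc _] ->.
  apply/ffunP=> u; rewrite conjgE !ffunE.
  have: c u.1 ^ t u.2 \in N by rewrite NJ.
  by move: (c u.1 ^ _) => p Np; rewrite cN ?mulgK ?groupM ?groupV.
apply/eqP/idP => [|Bf].
  exact: (@coset_idr _ B).
exact: (@coset_id _ B).
Qed.

Lemma mu_cocycle2 : t 1 = 1 -> [ffun u => mu t u.1 u.2] \in cocycle2 t.
Proof.
move=> t1; rewrite inE; apply/and3P; split.
- by apply/forallP=> u; rewrite ffunE mu_in.
- by apply/forallP=> x; rewrite !ffunE /mu /= !mul1g !mulg1 t1 mulg1 mul1g mulVg eqxx.
apply/forallP=> x; apply/forallP=> y; apply/forallP=> z; rewrite !ffunE /mu /=.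
rewrite conjgE (mulgA x y z) !mulgA !mulgK.
apply/eqP; do 2!congr (_ * _); rewrite -!mulgA; congr (_ * _).
Qed.

Lemma comp_C1_cocycle2 theta f :
    theta \in C1 t -> f \in cocycle2 t ->
  [ffun u => theta (f u)] \in cocycle2 t.
Proof.
case/setIdP=> Atheta /forall_inP C1theta; rewrite !inE.
have thM : {in N &, {morph theta : a b / a * b}}.
  by move=> a b Na Nb; rewrite -(autmE Atheta) morphM.
have th1 : theta 1 = 1 by rewrite -(autmE Atheta) morph1.
have thJ a x : a \in N -> theta (a ^ t x) = theta a ^ t x.
  by move=> Na; apply/eqP/(forallP (C1theta a Na)).
case/and3P=> /forallP Nf /forallP f1 /forallP cf; apply/and3P; split.
- by apply/forallP=> u; rewrite ffunE Aut_closed.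
- apply/forallP=> x; rewrite !ffunE; have /andP[/eqP-> /eqP->] := f1 x.
  by rewrite th1 eqxx.
apply/forallP=> x; apply/forallP=> y; apply/forallP=> z; rewrite !ffunE.
by rewrite -thJ // -!thM ?NJ // (eqP (forallP (forallP (cf x) y) z)).
Qed.

Lemma comp_C2_cocycle2 phi f :
    phi \in C2 t -> f \in cocycle2 t ->
  [ffun u => f (phi u.1, phi u.2)] \in cocycle2 t.
Proof.
case/setIdP=> Aphi /forall_inP C2phi; rewrite !inE.
have phM : {morph phi : x y / x * y}.
  by move=> x y; rewrite -(autmE Aphi) morphM ?inE.
have ph1 : phi 1 = 1 by rewrite -(autmE Aphi) morph1.
case/and3P=> /forallP Nf /forallP f1 /forallP cf; apply/and3P; split.
- by apply/forallP=> u; rewrite ffunE.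
- by apply/forallP=> x; rewrite !ffunE /= ph1.
apply/forallP=> x; apply/forallP=> y; apply/forallP=> z; rewrite !ffunE /= !phM.
rewrite -(eqP (forallP (C2phi _ (Nf _)) z)).
exact: (forallP (forallP (cf (phi x)) (phi y)) (phi z)).
Qed.

End Facts.

(* Main.v *)
Require Import Defs.
From mathcomp Require Import all_boot all_fingroup all_solvable.

Import GroupScope.

(** A complement of [N], given by a homomorphic section [s], writes each [g]
    uniquely as [s x * n] with [n] in [N].  The transversal [t] differs from [s]
    by a cochain [chi], so [mu] is the coboundary of [chi] and the classes
    [lambda1], [lambda2], [lambda] are trivial on [C1], [C2] and (for [N]
    central) everywhere.  The map sending [(theta, phi)] to
    [s x * n |-> s (phi x) * theta n] is then a homomorphic section for each of
    the three sequences. *)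

(** Exactness at [Q] comes from the section. The group structures on the ends follow: [A] is a
    kernel and [Q] is the image of [E]. *)
Lemma split_short_exactI (aT rT : finGroupType) (A : {set aT})
    (E : {group aT}) (Q : {set rT}) (f : aT -> rT) (s : rT -> aT) :
    {in E &, {morph f : x y / x * y}} ->
    {in E, forall x, f x \in Q} ->
    [set x in E | f x == 1] = A ->
    {in Q &, {morph s : x y / x * y}} ->
    {in Q, forall q, s q \in E} ->
    {in Q, forall q, f (s q) = q} ->
  split_short_exact A E Q f.
Proof.
move=> fM fQ kerA sM sE sK.
have imE : f @: E = Q.
  apply/setP=> q; apply/imsetP/idP=> [[x Ex ->]|Qq]; first exact: fQ.
  by exists (s q); rewrite ?sK ?sE.
split; last by exists (Morphism sM).
split=> //; last by rewrite -kerA; apply/subsetP=> x /setIdP[].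
split; [|exact: groupP|].
- rewrite -kerA (_ : [set x in E | f x == 1] = 'ker (Morphism fM)) ?groupP //.
  by apply/setP=> x; rewrite !inE.
- by rewrite -imE -[f @: E](morphimEdom (Morphism fM)) groupP.
Qed.

(** Pointwise form of the fact that, for abelian values, a quotient of coboundaries is the
    coboundary of the quotient. *)
Lemma abelian_divM (gT : finGroupType) (A : {group gT}) (a b c a' b' c' : gT) :
    abelian A -> a \in A -> b \in A -> c \in A -> a' \in A -> b' \in A ->
    c' \in A ->
  a * b * c^-1 * (a' * b' * c'^-1)^-1
    = a * a'^-1 * (b * b'^-1) * (c * c'^-1)^-1.
Proof.
move=> abA Aa Ab Ac Aa' Ab' Ac'.
have VM : {in A &, forall x y, (x * y)^-1 = x^-1 * y^-1}.
  by move=> x y Ax Ay; rewrite invMg (centsP abA) ?groupV.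
have MACA x y z w : y \in A -> z \in A -> x * y * (z * w) = x * z * (y * w).
  by move=> Ay Az; rewrite -!mulgA (mulgA y) (centsP abA y) // !mulgA.
rewrite !VM ?groupM ?groupV // MACA ?groupM ?groupV //.
by congr (_ * _); rewrite MACA ?groupV.
Qed.

(** * Automorphisms preserving [N] *)

Section Splitting.

Variables (gT : finGroupType) (N : {group gT}).
Hypothesis nsN : N <| [set: gT].
Local Notation H := (coset_of N).
Implicit Types (a b : gT) (x y : H) (g h : {perm gT}).

Let nNx a : a \in 'N(N).
Proof. by apply: subsetP (in_setT a); case/andP: nsN. Qed.

Let cosetM a b : coset N (a * b) = coset N a * coset N b.
Proof. exact: morphM. Qed.

Let cosetV a : coset N a^-1 = (coset N a)^-1.
Proof. exact: morphV. Qed.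

Let NJ a b : (a ^ b \in N) = (a \in N).
Proof. exact: memJ_norm. Qed.

(** [a] and [b] differ by an element of [N], which commutes with [n ^ b]. Hence [t] and [s] define
    the same action of [H]. *)
Lemma conjg_coset n a b :
  abelian N -> n \in N -> coset N a = coset N b -> n ^ a = n ^ b.
Proof.
move=> abN Nn ab; rewrite -[a](mulKVg b) conjgM [LHS]conjgE.
rewrite (centsP abN (n ^ b) _ (b^-1 * a)) ?mulKg ?NJ //.
by apply: coset_idr => //; rewrite cosetM cosetV ab mulVg.
Qed.

Lemma conjg_central n a : N \subset 'Z([set: gT]) -> n \in N -> n ^ a = n.
Proof.
move=> /subsetP cN /cN /centerP[_ /(_ a (in_setT a)) nC].
by rewrite conjgE nC mulKg.
Qed.

Lemma Aut_stabM g : g \in Aut_stab N -> {morph g : a b / a * b}.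
Proof. by case/setIP=> Ag _ a b; rewrite -(autmE Ag) morphM ?inE. Qed.

Lemma Aut_stab_in g a : g \in Aut_stab N -> (g a \in N) = (a \in N).
Proof. by case/setIP=> _ /astabsP/(_ a). Qed.

Lemma Aut_stabJ g a b : g \in Aut_stab N -> g (a ^ b) = g a ^ g b.
Proof.
move=> Sg; apply: (mulgI (g b)).
by rewrite -Aut_stabM // -!conjgC Aut_stabM.
Qed.

Lemma Aut_fix_sub : Aut_fix N \subset Aut_stab N.
Proof. by apply: setIS; apply: astab_sub. Qed.

Lemma Aut_fixE g :
  (g \in Aut_fix N) = (g \in Aut_stab N) && (restr_perm N g == 1).
Proof.
rewrite !inE -!andbA; congr (_ && _).
by have /setP/(_ g) := ker_restr_perm N; rewrite !inE => <-.
Qed.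

Lemma Aut_fix_id g n : g \in Aut_fix N -> n \in N -> g n = n.
Proof. by case/setIP=> _ /astabP; apply. Qed.

Lemma quo_permM : {in Aut_stab N &, {morph quo_perm N : g h / g * h}}.
Proof.
move=> g h Sg Sh; apply/permP=> x; have [a _ ->] := cosetP x.
by rewrite permM !quo_permE ?groupM // permM.
Qed.

Lemma restr_permM : {in Aut_stab N &, {morph restr_perm N : g h / g * h}}.
Proof. by move=> g h /setIP[_ Ng] /setIP[_ Nh]; rewrite morphM. Qed.

Lemma Aut_stab_quo_group : group_set (Aut_stab_quo N).
Proof.
rewrite /Aut_stab_quo.
rewrite (_ : [set _ in _ | _] = 'ker (Morphism quo_permM)) ?groupP //.
by apply/setP=> x; rewrite !inE.
Qed.

Lemma quo_perm_Aut g : g \in Aut_stab N -> quo_perm N g \in Aut [set: H].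
Proof.
move=> Sg; rewrite inE; apply/andP; split.
  by apply/subsetP=> x; rewrite inE.
apply/morphicP=> x y _ _; have [a _ ->] := cosetP x; have [b _ ->] := cosetP y.
by rewrite -cosetM !quo_permE // Aut_stabM.
Qed.

Lemma restr_perm_stab_Aut g : g \in Aut_stab N -> restr_perm N g \in Aut N.
Proof. by case/setIP=> Ag _; apply: Aut_restr_perm Ag; apply: subsetT. Qed.

Lemma restr_perm_stabE g n :
  g \in Aut_stab N -> n \in N -> restr_perm N g n = g n.
Proof. by case/setIP=> _ Ng Nn; apply: restr_permE. Qed.

Lemma Aut_astabs g : g \in Aut N -> g \in 'N(N | 'P).
Proof.
move=> Ag; apply/astabsP=> a; apply/idP/idP; last exact: Aut_closed.
by apply: contraTT => nNa; rewrite /= apermE (out_Aut Ag).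
Qed.

Lemma restr_perm_AutE g : g \in Aut N -> restr_perm N g = g.
Proof.
move=> Ag; apply/permP=> a; have [Na | nNa] := boolP (a \in N).
  by rewrite restr_permE ?Aut_astabs.
by rewrite (out_perm (restr_perm_on _ _)) ?(out_Aut Ag).
Qed.

Hypothesis abN : abelian N.

Section Transversal.

Variable t : H -> gT.
Hypotheses (tK : forall x, coset N (t x) = x) (t1 : t 1 = 1).

(** [g (t x)] and [t x] lie in the same coset of [N], so they conjugate [g n] alike. *)
Lemma restr_perm_C1 g : g \in Aut_stab_quo N -> restr_perm N g \in C1 t.
Proof.
case/setIdP=> Sg /eqP g1; rewrite inE restr_perm_stab_Aut //=.
apply/forall_inP=> n Nn; apply/forallP=> x.
rewrite !restr_perm_stabE ?NJ // Aut_stabJ //; apply/eqP/conjg_coset => //.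
  by rewrite Aut_stab_in.
by rewrite -quo_permE // g1 perm1.
Qed.

(** Applying [g] to [n ^ t x], which it fixes, gives [n ^ g (t x)], and [g (t x)] represents the
    image of [x]. *)
Lemma quo_perm_C2 g : g \in Aut_fix N -> quo_perm N g \in C2 t.
Proof.
move=> Fg; have Sg := subsetP Aut_fix_sub _ Fg.
rewrite inE quo_perm_Aut //=.
apply/forall_inP=> n Nn; apply/forallP=> x; apply/eqP.
rewrite (conjg_coset n _ (g (t x))) ?tK -?quo_permE ?tK //.
by rewrite -{1}(Aut_fix_id g n) // -Aut_stabJ // Aut_fix_id ?NJ.
Qed.

Lemma one_C1 : 1 \in C1 t.
Proof.
rewrite inE group1; apply/forall_inP=> n _; apply/forallP=> x.
by rewrite !perm1.
Qed.

Lemma one_C2 : 1 \in C2 t.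
Proof.
rewrite inE group1; apply/forall_inP=> n _; apply/forallP=> x.
by rewrite !perm1.
Qed.

(** [H] acts trivially on a central [N], so compatibility with the action is automatic. *)
Lemma C1_central : N \subset 'Z([set: gT]) -> C1 t = Aut N.
Proof.
move=> cN; have J1 n a := conjg_central n a cN.
apply/setP=> theta; rewrite inE andb_idr // => Atheta.
apply/forall_inP=> n Nn; apply/forallP=> x.
by rewrite !J1 ?Aut_closed.
Qed.

Lemma C2_central : N \subset 'Z([set: gT]) -> C2 t = Aut [set: H].
Proof.
move=> cN; have J1 n a := conjg_central n a cN.
apply/setP=> phi; rewrite inE andb_idr // => _.
by apply/forall_inP=> n Nn; apply/forallP=> x; rewrite !J1.
Qed.

(** * Coordinates given by a homomorphic section *)

Variable s : H -> gT.
Hypotheses (sM : {morph s : x y / x * y}) (sK : forall x, coset N (s x) = x).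

Let nu a : gT := (s (coset N a))^-1 * a.

Let nu_in a : nu a \in N.
Proof.
by apply: coset_idr => //; rewrite /nu cosetM cosetV sK mulVg.
Qed.

Let nuK a : s (coset N a) * nu a = a.
Proof. exact: mulKVg. Qed.

Let coset_sM x n : n \in N -> coset N (s x * n) = x.
Proof. by move=> Nn; rewrite cosetM sK (coset_id Nn) mulg1. Qed.

Let nu_sM x n : n \in N -> nu (s x * n) = n.
Proof. by move=> Nn; rewrite /nu coset_sM // mulKg. Qed.

Let s1 : s 1 = 1.
Proof. by apply: (mulgI (s 1)); rewrite -sM !mulg1. Qed.

(** The [N]-coordinate is a crossed homomorphism because [s] is multiplicative. *)
Let nuM a b : nu (a * b) = nu a ^ s (coset N b) * nu b.
Proof. by rewrite /nu cosetM sM conjgE invMg !mulgA !mulgK. Qed.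

Let C1M theta :
  theta \in C1 t -> {in N &, {morph theta : a b / a * b}}.
Proof.
by case/setIdP=> Ath _ a b Na Nb; rewrite -(autmE Ath) morphM.
Qed.

Let C1_in theta n : theta \in C1 t -> n \in N -> theta n \in N.
Proof. by case/setIdP=> Ath _; apply: Aut_closed. Qed.

Let C1V theta n : theta \in C1 t -> n \in N -> theta n^-1 = (theta n)^-1.
Proof.
by case/setIdP=> Ath _ Nn; rewrite -(autmE Ath) morphV.
Qed.

Let C2M phi : phi \in C2 t -> {morph phi : x y / x * y}.
Proof.
by case/setIdP=> Aph _ x y; rewrite -(autmE Aph) morphM ?inE.
Qed.

(** [theta] commutes with the action and [phi] does not change it. This joint equivariance makes the
    lift multiplicative. *)
Let C12J theta phi n x : theta \in C1 t -> phi \in C2 t -> n \in N ->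
  theta (n ^ s x) = theta n ^ s (phi x).
Proof.
move=> C1th C2ph Nn; have Nthn := C1_in theta n C1th Nn.
have sE m y : m \in N -> m ^ s y = m ^ t y.
  by move=> Nm; apply: conjg_coset; rewrite ?tK.
case/setIdP: C1th => _ /forall_inP/(_ _ Nn)/forallP/(_ x)/eqP.
case/setIdP: C2ph => _ /forall_inP/(_ _ Nthn)/forallP/(_ x)/eqP.
by rewrite !sE // => -> ->.
Qed.

(** * Triviality of the cohomology classes *)

Let chi x := nu (t x).

Let muE x y : mu t x y = chi x ^ s y * chi y * (chi (x * y))^-1.
Proof.
have tE z : t z = s z * chi z by rewrite -{1}(nuK (t z)) tK.
rewrite /mu !tE sM.
have Nxy : chi x ^ s y * chi y \in N.
  by apply: groupM; [rewrite NJ|]; apply: nu_in.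
have NVxy : (chi (x * y))^-1 \in N by rewrite groupV; apply: nu_in.
(* Inverting [t (x * y)] leaves [(chi (x * y))^-1] on the left; commutativity of [N] moves it to the
   right. *)
by rewrite (centsP abN _ Nxy _ NVxy) conjgE !invMg -!mulgA mulKg.
Qed.

(** One statement serves all three classes: [lambda1] is the case [phi = 1], and [lambda2] the case
    [theta = 1]. *)
Lemma coboundary_mu theta phi : theta \in C1 t -> phi \in C2 t ->
  [ffun u => mu t (phi u.1) (phi u.2) * (theta (mu t u.1 u.2))^-1]
    \in coboundary2 t.
Proof.
move=> C1th C2ph; have ph1 : phi 1 = 1.
  by case/setIdP: C2ph => Aph _; rewrite -(autmE Aph) morph1.
have chi1 : chi 1 = 1 by rewrite /chi t1 /nu coset_id // s1 invg1 mulg1.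
have th1 : theta 1 = 1.
  by case/setIdP: C1th => Ath _; rewrite -(autmE Ath) morph1.
have Nchi x : chi x \in N := nu_in _.
(* [mu] is the coboundary of [chi]. Precomposing with [phi] replaces [chi] by [chi \o phi],
   postcomposing with [theta] replaces it by [theta \o chi]; the witness is their quotient. *)
apply/imsetP; exists [ffun x => chi (phi x) * (theta (chi x))^-1].
  rewrite inE; apply/andP; split.
    by apply/forallP=> x; rewrite ffunE groupM ?groupV ?C1_in.
  by rewrite ffunE ph1 chi1 th1 invg1 mulg1.
(* Coboundaries use the action of [t y], whereas expanding [mu] at [phi x], [phi y] produces
   [s (phi y)]. *)
have actE n y : n \in N -> n ^ t y = n ^ s (phi y).
  move=> Nn; case/setIdP: C2ph => _ /forall_inP/(_ n Nn)/forallP/(_ y)/eqP <-.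
  by apply: conjg_coset; rewrite ?tK.
have Nth n : n \in N -> theta n \in N by apply: C1_in.
have thE a b c y : a \in N -> b \in N -> c \in N ->
    theta (a ^ s y * b * c^-1) = theta a ^ s (phi y) * theta b * (theta c)^-1.
  move=> Na Nb Nc; have Nay : a ^ s y \in N by rewrite NJ.
  rewrite (C1M _ C1th (a ^ s y * b)) ?(groupM Nay Nb) ?groupV //.
  by rewrite (C1M _ C1th (a ^ s y)) // (C1V _ _ C1th) // (C12J _ phi).
apply/ffunP=> -[x y]; rewrite !ffunE /= !muE -(C2M _ C2ph) thE ?Nchi //.
have Nquo : chi (phi x) * (theta (chi x))^-1 \in N.
  by apply: groupM; rewrite ?groupV ?Nth ?Nchi.
rewrite (actE _ y Nquo) (conjMg (chi (phi x))) conjVg.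
by apply: (abelian_divM _ N); rewrite ?NJ ?Nth ?Nchi.
Qed.

Lemma C1star_split : C1star t = C1 t.
Proof.
apply/setP=> theta; rewrite inE andb_idr // => C1th.
rewrite /lambda1 H2_class_eq1 // => [|u]; last first.
  by rewrite ffunE groupM ?C1_in ?groupV ?mu_in.
apply: etrans (coboundary_mu _ _ C1th one_C2); apply: (congr1 (in_mem^~ _)).
by apply/ffunP=> u; rewrite !ffunE !perm1 C1V ?mu_in.
Qed.

Lemma C2star_split : C2star t = C2 t.
Proof.
apply/setP=> phi; rewrite inE andb_idr // => C2ph.
rewrite /lambda2 H2_class_eq1 // => [|u]; last first.
  by rewrite ffunE groupM ?groupV ?mu_in.
apply: etrans (coboundary_mu _ _ one_C1 C2ph); apply: (congr1 (in_mem^~ _)).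
by apply/ffunP=> u; rewrite !ffunE !perm1.
Qed.

Lemma Cstar_split_central :
  N \subset 'Z([set: gT]) -> Cstar t = setX (C1 t) (C2 t).
Proof.
move=> cN; rewrite C1_central ?C2_central //.
apply/setP=> -[theta phi]; rewrite inE andb_idr //= => /setXP[/=].
rewrite -C1_central // -C2_central // => C1th C2ph.
rewrite /lambda H2_class_eq1 ?coboundary_mu // => u.
by rewrite ffunE groupM ?groupV ?C1_in ?mu_in.
Qed.

(** * Lifting pairs to automorphisms *)

(* Restricting to [N] is harmless for [p.1] in [Aut N] and makes the map
   injective for every [p], as the definition of a permutation requires. *)
Definition lift_fun (p : {perm gT} * {perm H}) a : gT :=
  s (p.2 (coset N a)) * restr_perm N p.1 (nu a).

(** The coset of the value determines that of the argument, as [p.2] is injective; cancelling the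
    [s] factor then determines the [N]-coordinate. *)
Lemma lift_fun_inj p : injective (lift_fun p).
Proof.
have rN n : n \in N -> restr_perm N p.1 n \in N.
  by rewrite -{1}(perm_closed _ (restr_perm_on N p.1)).
move=> a b; rewrite /lift_fun => eq_ab.
have ab : coset N a = coset N b.
  apply: (@perm_inj _ p.2).
  by rewrite -(coset_sM (p.2 _) _ (rN _ (nu_in a))) eq_ab coset_sM ?rN.
rewrite -(nuK a) -(nuK b) -ab; congr (_ * _).
apply: (@perm_inj _ (restr_perm N p.1)).
by apply: (mulgI (s (p.2 (coset N a)))); rewrite eq_ab ab.
Qed.

Definition lift p : {perm gT} := perm (lift_fun_inj p).

Section LiftC.

Variables (theta : {perm gT}) (phi : {perm H}).
Hypotheses (C1th : theta \in C1 t) (C2ph : phi \in C2 t).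

Lemma liftE a : lift (theta, phi) a = s (phi (coset N a)) * theta (nu a).
Proof. by rewrite permE /lift_fun restr_perm_AutE //; case/setIdP: C1th. Qed.

Lemma coset_lift a : coset N (lift (theta, phi) a) = phi (coset N a).
Proof. by rewrite liftE coset_sM ?C1_in. Qed.

Lemma lift_N n : n \in N -> lift (theta, phi) n = theta n.
Proof.
move=> Nn; rewrite liftE /nu coset_id //.
case/setIdP: C2ph => Aph _; rewrite -{1}(autmE Aph) morph1.
by rewrite s1 invg1 !mul1g.
Qed.

Lemma lift_stab : lift (theta, phi) \in Aut_stab N.
Proof.
apply/setIP; split; last first.
  apply/astabsP=> a; apply/idP/idP => /= [|Na]; rewrite apermE; last first.
    by rewrite lift_N ?C1_in.
  (* If the lift of [a] is in [N], then [phi] sends the coset of [a] to [1], so that coset is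
     trivial. *)
  move=> /coset_id; rewrite coset_lift => ph1; apply: coset_idr => //.
  apply: (@perm_inj _ phi); rewrite ph1.
  by case/setIdP: C2ph => Aph _; rewrite -{1}(autmE Aph) morph1.
rewrite inE; apply/andP; split; first by apply/subsetP=> a; rewrite inE.
(* By [nuM] and [C12J], [theta (nu a)] gets conjugated by [s (phi (coset N b))], exactly as when it
   is moved past that factor. *)
apply/morphicP=> a b _ _; rewrite !liftE nuM cosetM C2M // sM.
rewrite C1M ?NJ // (C12J _ phi) // conjgE -!mulgA; congr (_ * _).
exact: mulKVg.
Qed.

Lemma quo_lift : quo_perm N (lift (theta, phi)) = phi.
Proof.
apply/permP=> x; have [a _ ->] := cosetP x.
by rewrite quo_permE ?lift_stab // coset_lift.
Qed.

Lemma restr_lift : restr_perm N (lift (theta, phi)) = theta.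
Proof.
have Ath : theta \in Aut N by case/setIdP: C1th.
have Alift := restr_perm_stab_Aut _ lift_stab.
apply/permP=> a; have [Na | nNa] := boolP (a \in N).
  by rewrite restr_perm_stabE ?lift_stab ?lift_N.
by rewrite (out_Aut Alift) ?(out_Aut Ath).
Qed.

End LiftC.

(** In the coordinates given by [s], a lift acts by [phi] and [theta] separately. *)
Lemma liftM p q :
    p.1 \in C1 t -> p.2 \in C2 t -> q.1 \in C1 t -> q.2 \in C2 t ->
  lift (p * q) = lift p * lift q.
Proof.
case: p q => th ph [th' ph'] /= C1th C2ph C1th' C2ph'.
have [/setIdP[Ath _] /setIdP[Ath' _]] := (C1th, C1th').
apply/permP=> a; rewrite permM [RHS]liftE // coset_lift // (liftE th) //.
rewrite nu_sM ?C1_in // permE /lift_fun /= permM.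
by rewrite restr_perm_AutE ?groupM ?permM.
Qed.

(** * The split sequences over [C1], [C2] and their product *)

Lemma split_Aut_stab_quo :
  split_short_exact (Aut_fix_quo N) (Aut_stab_quo N) (C1 t) (restr_perm N).
Proof.
have sub g : g \in Aut_stab_quo N -> g \in Aut_stab N by case/setIdP.
apply: (split_short_exactI _ _ _ (Group Aut_stab_quo_group) _ _
          (fun theta => lift (theta, 1))).
- by move=> g h /sub Sg /sub Sh; apply: restr_permM.
- exact: restr_perm_C1.
- by apply/setP=> g; rewrite [RHS]inE Aut_fixE andbAC inE [X in X && _]inE.
(* Writing [1] as [1 * 1] turns the pair into a product of pairs, so that [liftM] applies. *)
- by move=> th th' C1th C1th'; rewrite -[X in (_, X)]mulg1 -liftM ?one_C2.
- by move=> th C1th; rewrite inE lift_stab ?quo_lift ?one_C2 /=.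
- by move=> th C1th; rewrite restr_lift ?one_C2.
Qed.

Lemma split_Aut_fix :
  split_short_exact (Aut_fix_quo N) (Aut_fix N) (C2 t) (quo_perm N).
Proof.
have sub g : g \in Aut_fix N -> g \in Aut_stab N by apply/subsetP/Aut_fix_sub.
apply: (split_short_exactI _ _ _ ('C_(Aut [set: gT])(N | 'P)) _ _
          (fun phi => lift (1, phi))).
- by move=> g h /sub Sg /sub Sh; apply: quo_permM.
- exact: quo_perm_C2.
- by [].
- by move=> ph ph' C2ph C2ph'; rewrite -[X in (X, _)]mulg1 -liftM ?one_C1.
- by move=> ph C2ph; rewrite Aut_fixE lift_stab ?restr_lift ?one_C1 /=.
- by move=> ph C2ph; rewrite quo_lift ?one_C1.
Qed.

Lemma split_Aut_stab_central :
    N \subset 'Z([set: gT]) ->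
  split_short_exact (Aut_fix_quo N) (Aut_stab N) (setX (C1 t) (C2 t))
    (fun g => (restr_perm N g, quo_perm N g)).
Proof.
move=> cN.
apply: (split_short_exactI _ _ _ ('N_(Aut [set: gT])(N | 'P)) _ _ lift).
- by move=> g h Sg Sh; rewrite restr_permM ?quo_permM.
- move=> g Sg; apply/setXP; split => /=.
    by rewrite C1_central ?restr_perm_stab_Aut.
  by rewrite C2_central ?quo_perm_Aut.
- by apply/setP=> g; rewrite [RHS]inE Aut_fixE -andbA inE.
- by move=> [? ?] [? ?] /setXP[? ?] /setXP[? ?]; apply: liftM.
- by case=> th ph /setXP[? ?]; apply: lift_stab.
- by case=> th ph /setXP[? ?]; rewrite restr_lift ?quo_lift.
Qed.

End Transversal.

End Splitting.

Theorem theorem8 (gT : finGroupType) (N : {group gT})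
    (nsN : N <| [set: gT]) (abN : abelian N)
    (splitG : split_short_exact N [set: gT] [set: coset_of N] (coset N))
    (t : coset_of N -> gT)
    (tK : forall x : coset_of N, coset N (t x) = x) (t1 : t 1 = 1) :
  [/\ split_short_exact (Aut_fix_quo N) (Aut_stab_quo N) (C1star t)
        (restr_perm N),
      split_short_exact (Aut_fix_quo N) (Aut_fix N) (C2star t)
        (quo_perm N)
    & N \subset 'Z([set: gT]) ->
      split_short_exact (Aut_fix_quo N) (Aut_stab N) (Cstar t)
        (fun g => (restr_perm N g, quo_perm N g))].
Proof.
case: splitG => _ [s _ sK0].
have sM : {morph s : x y / x * y} by move=> x y; rewrite morphM ?inE.
have sK x : coset N (s x) = x by rewrite sK0 ?inE.
split=> [||cN].
(* In each case the starred group is first replaced by the group of compatible automorphisms or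
   pairs, all classes being trivial; the lift is then the section. *)
- rewrite (C1star_split _ _ nsN abN _ tK t1 s sM sK).
  exact: (split_Aut_stab_quo _ _ nsN abN _ tK s sM sK).
- rewrite (C2star_split _ _ nsN abN _ tK t1 s sM sK).
  exact: (split_Aut_fix _ _ nsN abN _ tK s sM sK).
- rewrite (Cstar_split_central _ _ nsN abN _ tK t1 s sM sK cN).
  exact: (split_Aut_stab_central _ _ nsN abN _ tK s sM sK cN).
Qed.
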